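(* Let $f$, $X$, $U$, $\alpha$ be the data of a discrete-time polynomial control system as in the context, with maximum controlled invariant (MCI) set $X_I$. Consider the linear program $$p^* = \sup\ \mu_0(X)$$ where the supremum is over all $(\mu,\mu_0,\hat\mu_0)\in M(X\times U)\times M(X)\times M(X)$ subject to $$\int v(x)\,d\mu(x,u)=\int v(x)\,d\mu_0(x)+\alpha\int v(f(x,u))\,d\mu(x,u)\quad\forall\, v\in C(X),$$ $$\int w(x)\,d\mu_0(x)+\int w(x)\,d\hat\mu_0(x)=\int w(x)\,d\lambda(x)\quad\forall\, w\in C(X),$$ $$\mu\ge0,\quad \mu_0\ge0,\quad \hat\mu_0\ge0,\qquad \mathrm{spt}\,\mu\subset X\times U,\quad \mathrm{spt}\,\mu_0\subset X,\quad \mathrm{spt}\,\hat\mu_0\subset X.$$ Then the optimal value of this program equals the volume of the MCI set, that is, $p^*=\lambda(X_I)$. Moreover, the supremum is attained by $\mu_0$ equal to the restriction of the Lebesgue measure to $X_I$.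
   Context: Discrete-time system: $x_{t+1}=f(x_t,u_t)$, $x_t\in X$, $u_t\in U$, $t\in\{0,1,\dots\}$, where $f$ has polynomial entries $f_i\in\mathbb{R}[x,u]$, $i=1,\dots,n$. The sets $X=\{x\in\mathbb{R}^n: g_{X_i}(x)\ge 0,\ i=1,\dots,n_X\}$ and $U=\{u\in\mathbb{R}^m: g_{U_i}(u)\ge0,\ i=1,\dots,n_U\}$ are compact, with $g_{X_i}\in\mathbb{R}[x]$ and $g_{U_i}\in\mathbb{R}[u]$. $\alpha\in(0,1)$ is a given discount factor. The maximum controlled invariant (MCI) set $X_I$ is the set of all $x_0\in X$ for which there exist sequences $\{x_t\}_{t=1}^\infty$ and $\{u_t\}_{t=0}^\infty$ with $x_{t+1}=f(x_t,u_t)$, $u_t\in U$ and $x_t\in X$ for all $t\in\{0,1,\dots\}$. $M(S)$ is the vector space of signed Borel measures with support contained in $S$; $\mathrm{spt}$ denotes the support (the smallest closed set whose complement has zero measure); $C(X)$ is the space of continuous functions on $X$; $\lambda$ is the $n$-dimensional Lebesgue measure. In the second constraint the integrals are over $X$; integrals against $\mu$ are over $X\times U$. *)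

(* Defs.v *)
From HB Require Import structures.
From mathcomp Require Import all_boot all_order all_algebra.
From mathcomp Require Import all_classical all_reals all_analysis.
From mathcomp Require Import measurable_realfun.
From mathcomp Require mpoly.

Set Implicit Arguments.
Unset Strict Implicit.
Unset Printing Implicit Defensive.

Import Order.TTheory GRing.Theory Num.Theory.
Import numFieldNormedType.Exports.

Local Open Scope classical_set_scope.
Local Open Scope ring_scope.
Local Open Scope ereal_scope.

Notation borel T := (g_sigma_algebraType (@open T)).

Section lebesgue_rV.
Variable R : realType.

(* Cavalieri's formula; it makes sense on arbitrary sets, but only the values
   on Borel sets are meaningful. *)
Fixpoint lebesgue_rV (n : nat) : set (borel 'rV[R]_n) -> \bar R :=
  match n with
  | 0 => fun A => \d_(0%R : borel 'rV[R]_0) A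
  | k.+1 => fun A => \int[lebesgue_measure]_(x in [set: R])
      @lebesgue_rV k [set y : 'rV[R]_k | A (row_mx (x%:M : 'rV[R]_1) y)]
  end.
Arguments lebesgue_rV : clear implicits.

Lemma open_measurable_borel (T : ptopologicalType) (A : set T) :
  open A -> measurable (A : set (borel T)).
Proof. by move=> oA; exact: sub_gen_smallest. Qed.

Lemma measurable_fun_borel_rV d (T : measurableType d) n
    (h : T -> borel 'rV[R]_n) :
  (forall i, measurable_fun setT (fun t => (h t : 'rV[R]_n) 0%R i : R)) ->
  measurable_fun setT h.
Proof.
move=> mh; apply: (@measurability _ _ T (borel 'rV[R]_n) setT h (@open 'rV[R]_n)) => //.
move=> _ [V oV] <-; rewrite setTI.
pose q (a : {ffun 'I_n -> rat}) : 'rV[R]_n := \row_i ratr (a i).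
pose B (p : {ffun 'I_n -> rat} * nat) : set T :=
  if `[< ball (q p.1) p.2.+1%:R^-1 `<=` V >]
  then \bigcap_(i in [set: 'I_n])
         [set t | (`|ratr (p.1 i) - (h t : 'rV[R]_n) 0%R i| < p.2.+1%:R^-1)%R]
  else set0.
rewrite (_ : h @^-1` V = \bigcup_p B p).
  apply: countable_bigcupT_measurable; first exact: countableP.
  move=> p; rewrite /B; case: asboolP => // _.
  apply: fin_bigcap_measurable => // i _.
  have mN : measurable_fun setT
      (fun t => `|ratr (p.1 i) - (h t : 'rV[R]_n) 0%R i|%R).
    by apply: measurableT_comp => //; exact: measurable_funB.
  have := mN measurableT `]-oo, (p.2.+1%:R^-1 : R)%R[%classic (measurable_itv _).
  rewrite setTI; congr measurable; apply/seteqP; split => t /=;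
    by rewrite in_itv.
apply/seteqP; split => [t /= Vht|t [p _]]; last first.
  rewrite /B; case: asboolP => // pO => bt.
  apply: pO; split => // i j.
  rewrite ord1 mxE; exact: (bt j).
have : nbhs (h t : 'rV[R]_n) V by exact: open_nbhs_nbhs.
rewrite -nbhs_ballE => -[e /= e0 eO].
have [k ke] : exists k : nat, (k.+1%:R^-1 < e / 2)%R.
  have e20 : (0 < e / 2)%R by rewrite divr_gt0.
  have := near_infty_natSinv_lt (PosNum e20).
  by move=> [k _ /(_ k (leqnn _))]; exists k.
have qi (i : 'I_n) : exists a : rat,
    (`|ratr a - (h t : 'rV[R]_n) 0%R i| < k.+1%:R^-1)%R.
  have k0 : (0 < k.+1%:R^-1 :> R)%R by rewrite invr_gt0.
  have /rat_in_itvoo [a] : ((h t : 'rV[R]_n) 0%R i - k.+1%:R^-1 <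
     (h t : 'rV[R]_n) 0%R i + k.+1%:R^-1)%R.
    by rewrite ltrD2l (lt_trans _ k0)// oppr_lt0.
  rewrite in_itv/= => /andP[a1 a2]; exists a.
  by rewrite ltr_distl a1 a2.
have [a ha] := choice qi.
exists ([ffun i => a i], k) => //; rewrite /B /=; case: asboolP.
  by move=> _ i _ /=; rewrite ffunE.
case=> y [_ yq]; apply: eO; split=> // i j.
rewrite ord1 /ball /= [e]splitr.
have := yq 0%R j; rewrite mxE ffunE /ball /= => yj.
rewrite (le_lt_trans (ler_distD (ratr (a j)) _ _))// ltrD//.
  by rewrite distrC (lt_trans (ha j)).
by rewrite (lt_trans yj).
Qed.


Lemma measurable_coord_rV n (j : 'I_n) :
  measurable_fun [set: borel 'rV[R]_n]
    ((fun y : 'rV[R]_n => y 0%R j) : borel 'rV[R]_n -> measurableTypeR R).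
Proof.
apply: (@measurability _ _ (borel 'rV[R]_n) (measurableTypeR R) setT _
  (@RGenOpens.G R)).
  exact: RGenOpens.measurableE.
move=> _ [V [x [y ->]]] <-; rewrite setTI; apply: open_measurable_borel.
have /continuousP := @coord_continuous R 1 n 0%R j; apply.
exact: interval_open.
Qed.

Definition box_rV n (a b : 'rV[R]_n) : set (borel 'rV[R]_n) :=
  [set x : 'rV[R]_n | forall i, x 0%R i \in `[a 0%R i, b 0%R i]].

Lemma measurable_box_rV n (a b : 'rV[R]_n) : measurable (box_rV a b).
Proof.
rewrite (_ : box_rV a b = \bigcap_(i in [set: 'I_n])
    ((fun y : 'rV[R]_n => y 0%R i) @^-1` `[a 0%R i, b 0%R i])); last first.
  by apply/seteqP; split => x /= h i; [move=> _; exact: h|exact: h].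
apply: fin_bigcap_measurable => // i _; rewrite -[X in measurable X]setTI.
exact: measurable_coord_rV.
Qed.

Let cons_rV n (p : measurableTypeR R * borel 'rV[R]_n) : borel 'rV[R]_n.+1 :=
  row_mx (p.1%:M : 'rV[R]_1) p.2.

Let cons_rV0 n p : (@cons_rV n p : 'rV[R]_n.+1) 0%R (lshift n (0 : 'I_1))%R = p.1.
Proof. by rewrite [LHS](row_mxEl (p.1%:M : 'rV[R]_1) p.2) mxE eqxx mulr1n. Qed.

Let cons_rVS n p j : (@cons_rV n p : 'rV[R]_n.+1) 0%R (rshift 1 j) =
  (p.2 : 'rV[R]_n) 0%R j.
Proof. by rewrite [LHS](row_mxEr (p.1%:M : 'rV[R]_1) p.2). Qed.

Let measurable_cons_rV n : measurable_fun setT (@cons_rV n).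
Proof.
apply: measurable_fun_borel_rV => i.
have [j ->|j ->] := split_ordP (i : 'I_(1 + n)).
  rewrite ord1 [X in measurable_fun _ X](_ : _ = fst) //.
  by apply/funext => p; exact: cons_rV0.
rewrite [X in measurable_fun _ X](_ : _ =
    (fun y => (y : 'rV[R]_n) 0%R j) \o snd); last first.
  by apply/funext => p; exact: cons_rVS.
apply: (@measurableT_comp _ _ _ _ _ _ _ _ _ (@measurable_coord_rV n j)); exact: measurable_snd.
Qed.

Let lebesgue_rV_ex n :
  exists2 m : {sigma_finite_measure set (borel 'rV[R]_n) -> \bar R},
  lebesgue_rV n = m & forall a b : 'rV[R]_n,
    (forall i, a 0 i <= b 0 i)%R -> 
    m (box_rV a b) = (\prod_i (b 0 i - a 0 i))%:E%R.
Proof.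
elim: n => [|n [m mE mbox]].
  exists (@dirac _ (borel 'rV[R]_0) 0%R R) => // a b _.
  by rewrite big_ord0 [LHS]diracE mem_set// => -[].
pose mu := pushforward (lebesgue_measure \x m) (@cons_rV n).
have muE : lebesgue_rV n.+1 = mu.
  apply/funext => A; rewrite /= mE /mu /pushforward /product_measure1.
  apply: eq_integral => x _ /=; congr (m _).
  by apply/seteqP; split => y; rewrite /xsection/= inE.
have mubox (a b : 'rV[R]_n.+1) : (forall i, a 0 i <= b 0 i)%R -> 
    mu (box_rV a b) = (\prod_i (b 0 i - a 0 i))%:E%R.
  move=> ab.
  rewrite /mu /pushforward (_ : _ @^-1` _ =
    `[a 0%R (lshift n (0 : 'I_1))%R, b 0%R (lshift n (0 : 'I_1))%R] `*`
    box_rV (\row_j a 0%R (rshift 1 j)) (\row_j b 0%R (rshift 1 j))); last first.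
    apply/seteqP; split => [p /= h|p [/= h0 hS]] /=.
      split; first by have := h (lshift n (0 : 'I_1)%R); rewrite cons_rV0.
      by move=> j; have := h (rshift 1 j); rewrite cons_rVS !mxE.
    move=> i; have [j ->|j ->] := split_ordP (i : 'I_(1 + n)).
      by rewrite ord1 cons_rV0.
    by rewrite cons_rVS; have := hS j; rewrite !mxE.
  rewrite [LHS]product_measure1E//; last exact: measurable_box_rV.
  rewrite [X in X * _]lebesgue_measure_itv/= mbox; last first.
    by move=> j; rewrite !mxE.
  rewrite (@big_split_ord _ _ _ 1 n) /= big_ord1 EFinM.
  congr (_ * _); last by congr EFin; apply: eq_bigr => j _; rewrite !mxE.
  rewrite lte_fin; case: ltP => // ba; congr EFin; apply/esym/eqP.
  by rewrite subr_eq0 eq_le ba/=; exact: ab.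
have sf : sigma_finite setT mu.
  exists (fun k => box_rV (const_mx (- k%:R)%R) (const_mx k%:R)).
    apply/seteqP; split => // x _.
    exists (Num.trunc (`|x : 'rV[R]_n.+1|%R)).+1 => // i; rewrite !mxE in_itv/=.
    rewrite -ler_norml (@le_trans _ _ `|x : 'rV[R]_n.+1|%R)//; last first.
      by apply: ltW; exact: truncnS_gt.
    by rewrite [leRHS]mx_normrE; apply: (le_bigmax _ (fun ij => `|x ij.1 ij.2|%R) (0%R, i)).
  move=> k; split; first exact: measurable_box_rV.
  rewrite mubox ?ltry// => i; rewrite !mxE.
  by rewrite (@le_trans _ _ 0%R)// oppr_le0.
pose sfmu : {sigma_finite_measure set (borel 'rV[R]_n.+1) -> \bar R} :=
  HB.pack mu (Measure_isSigmaFinite.Build _ _ _ mu sf).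
have mf := @measurable_cons_rV n.
by exists (sfmu mf mf mf).
Qed.

Let lebesgue_rV0 n : lebesgue_rV n set0 = 0.
Proof. by have [m -> _] := lebesgue_rV_ex n; exact: measure0. Qed.

Let lebesgue_rV_ge0 n A : 0 <= lebesgue_rV n A.
Proof. by have [m -> _] := lebesgue_rV_ex n; exact: measure_ge0. Qed.

Let lebesgue_rV_sigma_additive n : semi_sigma_additive (lebesgue_rV n).
Proof.
by have [m -> _] := lebesgue_rV_ex n; exact: measure_semi_sigma_additive.
Qed.

HB.instance Definition _ n := isMeasure.Build _ _ _ (lebesgue_rV n)
  (lebesgue_rV0 n) (@lebesgue_rV_ge0 n) (@lebesgue_rV_sigma_additive n).

Let lebesgue_rV_sigma_finite n : sigma_finite setT (lebesgue_rV n).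
Proof. by have [m -> _] := lebesgue_rV_ex n; exact: sigma_finiteT. Qed.

HB.instance Definition _ n := Measure_isSigmaFinite.Build _ _ _ (lebesgue_rV n)
  (@lebesgue_rV_sigma_finite n).

Lemma lebesgue_rV_box n (a b : 'rV[R]_n) : (forall i, a 0 i <= b 0 i)%R ->
  lebesgue_rV n (box_rV a b) = (\prod_i (b 0 i - a 0 i))%:E%R.
Proof. by have [m -> mbox] := lebesgue_rV_ex n; exact: mbox. Qed.

End lebesgue_rV.
Arguments lebesgue_rV : clear implicits.

(* By second countability this is the smallest closed set whose complement is
   mu-null when T is a finite-dimensional real space. *)
Definition spt (R : realType) (T : topologicalType)
    (mu : set T -> \bar R) : set T :=
  \bigcap_(C in [set C : set T | closed C /\ mu (~` C) = 0]) C.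

Section control_system.
Variables (R : realType) (n m : nat).

Definition semialgebraic_set k l (g : 'I_l -> mpoly.mpoly k R) :
    set 'rV[R]_k :=
  [set x | forall i, (0 <= mpoly.meval (fun j => x 0 j) (g i))%R].

Definition dynamics (f : 'I_n -> mpoly.mpoly (n + m) R)
    (x : 'rV[R]_n) (u : 'rV[R]_m) : 'rV[R]_n :=
  (\row_i mpoly.meval (fun j => row_mx x u 0 j) (f i))%R.

Variables (F : 'rV[R]_n -> 'rV[R]_m -> 'rV[R]_n).
Variables (X : set 'rV[R]_n) (U : set 'rV[R]_m).

Definition MCI : set 'rV[R]_n :=
  [set x0 | exists (x : nat -> 'rV[R]_n) (u : nat -> 'rV[R]_m), x 0%N = x0 /\
    forall t, [/\ X (x t), U (u t) & x t.+1 = F (x t) (u t)]].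

Variable alpha : R.

(* The nonnegative elements of the space of signed Borel measures are the
   finite measures, so nonnegativity is built into the types. Since F x u may
   lie outside X, v must have values there: v ranges over the continuous
   functions on the whole space, whose restrictions to X are all of C(X) by
   Tietze's theorem. *)
Record feasible
    (mu : {finite_measure set (borel ('rV[R]_n * 'rV[R]_m)%type) -> \bar R})
    (mu0 muhat0 : {finite_measure set (borel 'rV[R]_n) -> \bar R}) : Prop := {
  feasible_spt : spt mu `<=` X `*` U ;
  feasible_spt0 : spt mu0 `<=` X ;
  feasible_spthat0 : spt muhat0 `<=` X ;
  feasible_liouville : forall v : 'rV[R]_n -> R, continuous v ->
    \int[mu]_(z in X `*` U) (v z.1)%:E =
    \int[mu0]_(x in X) (v x)%:E +
    alpha%:E * \int[mu]_(z in X `*` U) (v (F z.1 z.2))%:E ;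
  feasible_lebesgue : forall w : 'rV[R]_n -> R, {within X, continuous w} ->
    \int[mu0]_(x in X) (w x)%:E + \int[muhat0]_(x in X) (w x)%:E =
    \int[lebesgue_rV R n]_(x in X) (w x)%:E }.

Definition optimal_value : \bar R :=
  ereal_sup [set p | exists mu mu0 muhat0,
    feasible mu mu0 muhat0 /\ p = mu0 X].

End control_system.

(* Main.v *)
(* Upper bound. Let K_0 = X and let K_(t+1) be the set of states of X that some
   control of U sends into K_t; by compactness the MCI set is the intersection of
   the K_t. Testing the Liouville equation against the distance to K_t shows, by
   induction on t, that mu and mu0 do not charge the states outside K_t, so mu0 is
   carried by the MCI set, where the second constraint bounds it by Lebesgue
   measure.

   Attainment. On the MCI set, the controls that keep the state in the MCI set
   form a compact-valued measurable multifunction; lexicographic minimization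
   selects a measurable feedback law from it. The discounted sum over t of the
   laws at time t of the closed-loop trajectories, started from the restriction of
   Lebesgue measure to the MCI set, solves the Liouville equation. *)

Require Import Defs.
From HB Require Import structures.
From mathcomp Require Import all_boot all_order all_algebra.
From mathcomp Require Import all_classical all_reals all_analysis.
From mathcomp Require Import measurable_realfun.
From mathcomp Require mpoly.
Import Order.TTheory GRing.Theory Num.Theory.
Import numFieldNormedType.Exports.
Local Open Scope classical_set_scope.
Local Open Scope ring_scope.
Local Open Scope ereal_scope.

Set Implicit Arguments.
Unset Strict Implicit.

(** * Continuity of the dynamics, closed sets as zero sets, compact projections *)

Lemma continuous_meval (R : realType) (T : topologicalType) (k : nat)
    (v : 'I_k -> T -> R) (p : mpoly.mpoly k R) :
  (forall i, continuous (v i)) ->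
  continuous (fun x => mpoly.meval (fun i => v i x) p).
Proof.
move=> cv; under eq_fun do rewrite mpoly.mevalE.
apply: continuous_big; first exact: add_continuous.
move=> d _ x; apply: continuousM; first exact: cst_continuous.
apply: continuous_big; first exact: mul_continuous.
by move=> i _ y; apply: (@continuous_comp _ _ _ (v i) (fun t => t ^+ _)%R);
  [exact: cv|exact: exprn_continuous].
Qed.

Lemma continuous_mx (R : realType) (T : topologicalType) (k l : nat)
    (h : T -> 'M[R]_(k, l)) :
  (forall i j, continuous (fun x => h x i j)) -> continuous h.
Proof.
move=> ch x; apply/cvg_ballP => e e0.
suff : \forall y \near x, forall ij : 'I_k * 'I_l,
    ball (h x ij.1 ij.2) e (h y ij.1 ij.2).
  by apply: filterS => y H; split => // i j; apply: (H (i, j)).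
apply: filter_forall => -[i j] /=.
by have /cvg_ballP/(_ _ e0) := ch i j x.
Qed.

Lemma continuous_dynamics (R : realType) (n m : nat)
    (f : 'I_n -> mpoly.mpoly (n + m) R) :
  continuous (fun z : 'rV[R]_n * 'rV[R]_m => dynamics f z.1 z.2).
Proof.
apply: continuous_mx => i j; under eq_fun do rewrite mxE.
apply: continuous_meval => {}j.
case: (split_ordP j) => k ->.
- under eq_fun do rewrite row_mxEl; move=> z.
  apply: (@continuous_comp _ _ _ fst (fun x : 'rV[R]_n => x 0%R k)); first exact: cvg_fst.
  exact: coord_continuous.
- under eq_fun do rewrite row_mxEr; move=> z.
  apply: (@continuous_comp _ _ _ snd (fun x : 'rV[R]_m => x 0%R k)); first exact: cvg_snd.
  exact: coord_continuous.
Qed.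

(** The distance to [C] does it. Such an [h] is the test function that turns a vanishing integral
    into a statement about the measure of the complement of [C]. *)
Lemma closed_zero_set (R : realType) (V : normedModType R) (C : set V) : closed C ->
  exists h : V -> R, [/\ continuous h, (forall x, 0 <= h x)%R &
    forall x, h x = 0%R <-> C x].
Proof.
move=> cC; have [->|/set0P[c0 Cc0]] := eqVneq C set0.
  (* The distance to the empty set is infinite and its [fine] part would be 0, hence the constant 1
     here. *)
  exists (cst 1%R); split=> //; first by move=> x; exact: cvg_cst.
  by move=> x; split => // /eqP; rewrite oner_eq0.
have efin x : edist_inf C x \is a fin_num.
  rewrite ge0_fin_numE; last exact: edist_inf_ge0.
  apply: (@le_lt_trans _ _ (edist (x, c0))).
    by apply: ereal_inf_lbound; exists c0.
  (* Finiteness of [edist] asks for an open ball around [x] containing [c0]; adding 1 makes the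
     radius exceed the distance strictly. *)
  rewrite -ge0_fin_numE ?edist_ge0//; apply/edist_finP; exists (`|x - c0| + 1)%R => /=.
    by rewrite ltr_wpDl.
  by rewrite -ball_normE /= ltrDl.
exists (fun x => fine (edist_inf C x)); split.
- move=> x; apply: fine_cvg; rewrite fineK//; exact: edist_inf_continuous.
- by move=> x; apply: fine_ge0; exact: edist_inf_ge0.
move=> x; split=> [|Cx]; last by rewrite /= edist_inf0.
move=> h0; apply: (@cC x) => B /nbhs_ballP[e /= e0 eB].
have e0' : edist_inf C x < e%:E by rewrite -(fineK (efin x)) [fine _]h0 lte_fin.
have [_ [c Cc <-] ce] := ereal_inf_lt e0'.
exists c; split=> //; apply: eB.
exact: (@edist_lt_ball _ _ _ (x, c)).
Qed.

Lemma continuous_pair (T V W : topologicalType) (f : T -> V) (g : T -> W) :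
  continuous f -> continuous g -> continuous (fun t => (f t, g t)).
Proof. by move=> cf cg t; apply: cvg_pair; [exact: cf|exact: cg]. Qed.

Lemma pair_continuousr (V W : topologicalType) (x : V) :
  continuous (fun w : W => (x, w)).
Proof. by apply: continuous_pair => w; [exact: cvg_cst|exact: cvg_id]. Qed.

(** The set is the first projection of a compact set of pairs; compactness of [B] keeps the
    quantifier over controls harmless. Both the viability kernels and the measurability of the
    feedback multifunction rest on this. *)
Lemma compact_controlled_preimage (V W Z : topologicalType) (G : V * W -> Z)
    (A : set V) (B : set W) (C : set Z) :
  continuous G -> compact A -> compact B -> closed C ->
  compact [set x | A x /\ exists2 u, B u & C (G (x, u))].
Proof.
move=> cG cA cB cC.
rewrite (_ : [set x | _] = fst @` ((A `*` B) `&` G @^-1` C)).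
  apply: continuous_compact.
    by apply: continuous_subspaceT => z; exact: cvg_fst.
  apply: compact_closedI; first exact: compact_setX.
  by apply: preimage_closed.
apply/seteqP; split=> [x [Ax [u Bu Cu]]|_ [[x u] [[/= Ax Bu] Cu] <-]].
  by exists (x, u).
by split=> //; exists u.
Qed.

(** * Viability kernels *)

Section viability.
Variables (R : realType) (n m : nat) (F : 'rV[R]_n -> 'rV[R]_m -> 'rV[R]_n).
Variables (X : set 'rV[R]_n) (U : set 'rV[R]_m).

(** These are the sets K_t of the overview. The recursion exposes the first control, so that one
    step of the dynamics links consecutive kernels. *)
Fixpoint viable (t : nat) : set 'rV[R]_n :=
  if t is s.+1 then [set x | X x /\ exists2 u, U u & viable s (F x u)] else X.

Lemma viable_decr t : viable t.+1 `<=` viable t.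
Proof.
elim: t => [|t IH] x [Xx [u Uu h]] //=.
by split=> //; exists u => //; exact: IH.
Qed.

Lemma viable_le s t : (s <= t)%N -> viable t `<=` viable s.
Proof.
move=> /subnK <-; elim: (t - s)%N => [//|k IH].
by apply: subset_trans IH; rewrite addSn; exact: viable_decr.
Qed.

Lemma MCI_step x : MCI F X U x ->
  exists2 u, U u & MCI F X U (F x u).
Proof.
move=> [y [u [y0 h]]]; exists (u 0%N); first by have [] := h 0%N.
exists (fun t => y t.+1), (fun t => u t.+1); split=> [|t]; last exact: h.
by have [_ _] := h 0%N; rewrite y0.
Qed.

Lemma MCI_sub : MCI F X U `<=` X.
Proof. by move=> x [y [u [<- /(_ 0%N)[]]]]. Qed.

(** One control chosen for each state of [S] is a feedback law, and iterating it produces the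
    infinite trajectory. With [MCI_step] and [MCI_sub] this makes the MCI set the largest controlled
    invariant subset of [X]. *)
Lemma sub_MCI (S : set 'rV[R]_n) : S `<=` X ->
  (forall x, S x -> exists2 u, U u & S (F x u)) -> S `<=` MCI F X U.
Proof.
move=> SX Sinv x0 Sx0.
have /choice[k hk] : forall x, exists u, S x -> U u /\ S (F x u).
  move=> x.
  have [/Sinv[u Uu Su]|nSx] := pselect (S x); first by exists u.
  by exists 0%R.
pose y t := iter t (fun x => F x (k x)) x0.
have Sy t : S (y t) by elim: t => //= t /hk[].
exists y, (k \o y); split=> // t; split=> //; first exact: SX.
by have [] := hk _ (Sy t).
Qed.

Hypotheses (cF : continuous (fun z : 'rV[R]_n * 'rV[R]_m => F z.1 z.2)).
Hypotheses (cX : compact X) (cU : compact U).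

Lemma compact_viable t : compact (viable t).
Proof.
elim: t => [//|t IH] /=.
apply: (compact_controlled_preimage cF cX cU).
by apply: compact_closed => //; exact: norm_hausdorff.
Qed.

Lemma closed_viable t : closed (viable t).
Proof.
by apply: compact_closed; [exact: norm_hausdorff|exact: compact_viable].
Qed.

(* The admissible controls at each horizon cluster, by compactness of U, to a
   control admissible at every horizon. *)
Lemma MCI_viable : MCI F X U = \bigcap_t viable t.
Proof.
apply/seteqP; split=> [x Ix t _|].
  elim: t x Ix => [|t IH] x Ix /=; first exact: MCI_sub.
  split; first exact: MCI_sub.
  by have [u Uu Iu] := MCI_step Ix; exists u => //; exact: IH.
apply: sub_MCI => [x /(_ 0%N I)//|x Kx].
have /choice[u hu] t : exists u, U u /\ viable t (F x u).
  by have [_ [u ? ?]] := Kx t.+1 I; exists u.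
have FU : (u @ \oo) U by exists 0%N => // t _ /=; have [] := hu t.
have [v [Uv clv]] := cU _ FU.
(* The kernels decrease, so [u s] is admissible at horizon [t] for all [s >= t]. Since [v] is a
   cluster point of this tail, every neighborhood of [F x v] meets the closed set [viable t]. *)
exists v => // t _; apply: (@closed_viable t (F x v)).
have cFx : {for v, continuous (F x)}.
  have := @continuous_comp _ _ _ (fun w => (x, w)) (fun z => F z.1 z.2) v.
  by apply; [exact: pair_continuousr|exact: cF].
move=> B /cFx FB.
have tE : (u @ \oo) [set w | viable t (F x w)].
  by exists t => // s ts /=; have [_] := hu s; exact: viable_le.
have [w [wt wB]] := clv _ _ tE FB.
by exists (F x w).
Qed.

Lemma closed_MCI : closed (MCI F X U).
Proof. by rewrite MCI_viable; apply: closed_bigI => t _; exact: closed_viable. Qed.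

Lemma compact_MCI : compact (MCI F X U).
Proof.
rewrite -(setIidr MCI_sub); apply: compact_closedI => //; exact: closed_MCI.
Qed.

End viability.

(** * Measurable selection *)

Section measurable_selection.
Variables (d : measure_display) (T : measurableType d) (R : realType).

Definition argmin (W : Type) (phi : W -> R) (A : set W) : set W :=
  [set u | A u /\ forall v, A v -> (phi u <= phi v)%R].

(* Castaing's notion of a measurable compact-valued multifunction *)
Definition measurable_multifunction (W : topologicalType) (G : T -> set W) :=
  (forall x, compact (G x)) /\
  (forall C, closed C -> measurable [set x | G x `&` C !=set0]).

Lemma closed_sublevel (W : topologicalType) (phi : W -> R) (c : R) :
  continuous phi -> closed [set u | (phi u <= c)%R].
Proof. by move=> cphi; apply: (closed_comp _ (@closed_le _ c)) => u _; exact: cphi. Qed.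

Lemma argmin_nonempty (W : topologicalType) (phi : W -> R) (A : set W) :
  continuous phi -> compact A -> A !=set0 -> argmin phi A !=set0.
Proof.
move=> cphi cA A0.
have [|c /set_mem Ac hc] := compact_EVT_min (f := phi) A0 cA.
  exact: continuous_subspaceT.
by exists c; split => // v Av; apply: hc; exact: mem_set.
Qed.

(* A closed set misses the minimizers exactly when some rational lies above the
   minimum and below the minimum over that closed set. *)
Lemma measurable_multifunction_argmin (W : topologicalType) (phi : W -> R)
    (G : T -> set W) : continuous phi ->
  measurable_multifunction G ->
  measurable_multifunction (fun x => argmin phi (G x)).
Proof.
move=> cphi [cG mG]; split=> [x|C cC].
  have -> : argmin phi (G x) =
      G x `&` \bigcap_(v in G x) [set u | (phi u <= phi v)%R].
    by apply/seteqP; split=> u [].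
  by apply: compact_closedI => //; apply: closed_bigI => v _; exact: closed_sublevel.
pose L q := [set u | (phi u <= ratr q)%R].
have cL q : closed (L q) by exact: closed_sublevel.
rewrite (_ : [set x | _] = [set x | G x `&` setT !=set0] `\`
    \bigcup_q ([set x | G x `&` L q !=set0] `\`
               [set x | G x `&` (C `&` L q) !=set0])).
  apply: measurableD; first by apply: mG; exact: closedT.
  apply: bigcupT_measurable_rat => q; apply: measurableD; apply: mG => //.
  exact: closedI.
apply/seteqP; split=> [x [u [[Gu umin] Cu]]|x [[u [Gu _]] noq]].
  split; first by exists u.
  move=> [q _ [[v [Gv vq]]]]; apply; exists u; split=> //; split=> //.
  exact: le_trans (umin _ Gv) vq.
have AB q : (G x `&` L q) !=set0 -> (G x `&` (C `&` L q)) !=set0.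
  by move=> Aq; apply: contrapT => nB; apply: noq; exists q.
have [u0 [Gu0 u0min]] : argmin phi (G x) !=set0.
  by apply: argmin_nonempty => //; exists u.
have [u1 [[Gu1 Cu1] u1min]] : argmin phi (G x `&` C) !=set0.
  apply: argmin_nonempty => //; first exact: compact_closedI.
  (* Any rational above the minimum of [phi] on [G x] serves: [AB] then yields a point of [G x] in
     [C]. *)
  have [q] : exists q : rat, (ratr q : R) \in `](phi u0), (phi u0 + 1)%R[%R.
    by have /rat_in_itvoo[q] : (phi u0 < phi u0 + 1)%R; [rewrite ltrDl|exists q].
  rewrite in_itv/= => /andP[/ltW uq _].
  have [|v [Gv [Cv _]]] := AB q; first by exists u0.
  by exists v.
exists u1; split=> //; split=> // v /u0min; apply: le_trans.
(* If the minimum over [C] were larger, a rational strictly between both minima would contradict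
   [AB]. *)
rewrite leNgt; apply/negP => /rat_in_itvoo[q]; rewrite in_itv/= => /andP[/ltW uq qu].
have [|w [Gw [Cw wq]]] := AB q; first by exists u0.
by have := u1min _ (conj Gw Cw); rewrite leNgt (le_lt_trans wq qu).
Qed.

(* Lexicographic minimization: minimizing one coordinate after the other
   shrinks the values to points. *)
Lemma measurable_selection (m : nat) (G : T -> set 'rV[R]_m) :
  measurable_multifunction G ->
  exists s : T -> 'rV[R]_m, measurable_fun setT (s : T -> borel 'rV[R]_m) /\
    forall x, G x !=set0 -> G x (s x).
Proof.
move=> mG.
have H j : exists G' : T -> set 'rV[R]_m, [/\ measurable_multifunction G',
    (forall x, G' x `<=` G x), (forall x, G x !=set0 -> G' x !=set0) &
    forall x u v, G' x u -> G' x v -> forall i : 'I_m, (i < j)%N -> u 0%R i = v 0%R i].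
  elim: j => [|j [G' [mG' G'G G'0 G'u]]]; first by exists G; split=> // x; exact: subset_refl.
  have [jm|mj] := ltnP j m; last first.
    (* All [m] coordinates are already fixed, so nothing is left to minimize. *)
    exists G'; split=> // x u v Gu Gv i _; apply: (G'u x) => //.
    exact: leq_trans (ltn_ord i) mj.
  pose phi (u : 'rV[R]_m) := u 0%R (Ordinal jm).
  have cphi : continuous phi by exact: coord_continuous.
  exists (fun x => argmin phi (G' x)); split.
  - exact: measurable_multifunction_argmin.
  - by move=> x u [/G'G].
  - move=> x /G'0; apply: argmin_nonempty => //; exact: mG'.1.
  move=> x u v [Gu umin] [Gv vmin] i; rewrite ltnS leq_eqVlt => /predU1P[ij|]; last first.
    by move=> ij; apply: (G'u x).
  have -> : i = Ordinal jm by exact: val_inj.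
  by apply/le_anti/andP; split; [exact: umin|exact: vmin].
have [G' [[_ mG'] G'G G'0 G'u]] := H m.
have /choice[s hs] : forall x, exists u,
    (G' x !=set0 -> G' x u) /\ (~ (G' x !=set0) -> u = 0%R).
  move=> x; have [[u Gu]|nG] := pselect (G' x !=set0); last by exists 0%R.
  by exists u; split=> [//|[]]; exists u.
exists s; split; last by move=> x /G'0; case: (hs x) => + _ => /[apply]; exact: G'G.
have ms C : closed C -> measurable (s @^-1` C).
  (* Where [G' x] is nonempty it is a single point, so [s x] lies in [C] exactly when [G' x] meets
     [C]. Elsewhere [s] has the default value 0, and this region enters the preimage entirely or not
     at all. *)
  move=> cC; have -> : s @^-1` C = [set x | G' x `&` C !=set0] `|`
      (~` [set x | G' x `&` setT !=set0] `&` [set x | C 0%R]).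
    apply/seteqP; split=> x /=; rewrite setIT; have [hs1 hs2] := hs x.
      move=> Csx; have [Gx|nG] := pselect (G' x !=set0).
        by left; exists (s x); split=> //; exact: hs1.
      by right; split=> //; rewrite -hs2.
    move=> [[u [Gu Cu]]|[nG C0]]; last by rewrite hs2.
    suff -> : s x = u by [].
    apply/rowP => i; apply: (G'u x) => //.
    by apply: hs1; exists u.
  apply: measurableU; first exact: mG'.
  apply: measurableI; first by apply: measurableC; apply: mG'; exact: closedT.
  have [C0|C0] := pselect (C 0%R).
    by rewrite (_ : [set _ | _] = setT)//; apply/seteqP; split.
  by rewrite (_ : [set _ | _] = set0)//; apply/seteqP; split.
apply: (@measurability _ _ T (borel 'rV[R]_m) setT s (@open 'rV[R]_m)) => //.
move=> _ [V oV] <-; rewrite setTI.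
have := measurableC (ms _ (open_closedC oV)).
by rewrite -preimage_setC setCK.
Qed.

End measurable_selection.

(** * Borel measurability of continuous maps, null sets, finite volume of compact sets *)

HB.instance Definition _ (V W : ptopologicalType) := Pointed.on (V * W)%type.

Lemma closed_setX (V W : topologicalType) (A : set V) (B : set W) :
  closed A -> closed B -> closed (A `*` B).
Proof.
move=> cA cB; rewrite (_ : A `*` B = fst @^-1` A `&` snd @^-1` B)//.
apply: closedI.
  by apply: preimage_closed => // z _; exact: cvg_fst.
by apply: preimage_closed => // z _; exact: cvg_snd.
Qed.

Lemma closed_measurable_borel (T : ptopologicalType) (C : set T) :
  closed C -> measurable (C : set (borel T)).
Proof.
move=> cC; rewrite -[C]setCK; apply: measurableC.
by apply: open_measurable_borel; exact: closed_openC.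
Qed.

Lemma continuous_measurable_borel (T T' : ptopologicalType) (h : T -> T') :
  continuous h -> measurable_fun setT (h : borel T -> borel T').
Proof.
move=> ch; apply: (@measurability _ _ (borel T) (borel T') setT h (@open T')) => //.
move=> _ [V oV] <-; rewrite setTI; apply: open_measurable_borel.
by move/continuousP : ch; exact.
Qed.

(** A relatively open preimage is the trace on [D] of an open set. The relative form suits the
    second constraint, whose test functions are continuous only within [X]. *)
Lemma within_continuous_measurable_borel (R : realType) (T : ptopologicalType)
    (D : set T) (h : T -> R) : measurable (D : set (borel T)) ->
  {within D, continuous h} ->
  measurable_fun (D : set (borel T)) (h : borel T -> measurableTypeR R).
Proof.
move=> mD /continuousP ch.
apply: (@measurability _ _ (borel T) (measurableTypeR R) D h (@RGenOpens.G R)).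
  exact: RGenOpens.measurableE.
move=> _ [V [x [y ->]]] <-.
have /open_subspaceP[V' oV' V'D] : open (from_subspace D h @^-1` `]x, y[%classic).
  by apply: ch; exact: interval_open.
rewrite setIC -V'D; apply: measurableI => //; exact: open_measurable_borel.
Qed.

Lemma continuous_measurable_real (R : realType) (T : ptopologicalType)
    (D : set T) (h : T -> R) : measurable (D : set (borel T)) -> continuous h ->
  measurable_fun (D : set (borel T)) (h : borel T -> measurableTypeR R).
Proof.
by move=> mD ch; apply: within_continuous_measurable_borel => //; exact: continuous_subspaceT.
Qed.

Lemma measurable_neq0 (d : measure_display) (T : measurableType d)
    (R : realType) (D : set T) (h : T -> R) :
  measurable D -> measurable_fun D h ->
  measurable (D `&` [set x | h x != 0%R]).
Proof.
move=> mD mh; have := mh mD _ (measurableC (measurable_set1 0%R)).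
by congr measurable; apply/seteqP; split=> x [Dx /eqP].
Qed.

(** This is the bridge between constraints, which are integrals of test functions, and supports,
    which concern null sets. Nonnegativity lets [h] be replaced by its absolute value. *)
Lemma integral_eq0_null (d : measure_display) (T : measurableType d)
    (R : realType) (mu : {measure set T -> \bar R}) (D : set T) (h : T -> R) :
  measurable D -> measurable_fun D h -> (forall x, 0 <= h x)%R ->
  \int[mu]_(x in D) (h x)%:E = 0 <-> mu (D `&` [set x | h x != 0%R]) = 0.
Proof.
move=> mD mh h0.
have mE : measurable_fun D (EFin \o h) by exact/measurable_EFinP.
have mN := measurable_neq0 mD mh.
have <- : \int[mu]_(x in D) `|(EFin \o h) x| = \int[mu]_(x in D) (h x)%:E.
  by apply: eq_integral => x _; rewrite /= ger0_norm.
split=> [/(ae_eq_integral_abs mu mD mE)[N [mN' N0 sub]]|N0].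
  apply: (subset_measure0 _ _ _ N0) => // x [Dx /eqP hx]; apply: sub => /= H.
  by apply: hx; have [] := H Dx.
apply/(ae_eq_integral_abs mu mD mE).
exists (D `&` [set x | h x != 0%R]); split=> // x /= /not_implyP[Dx hx].
by split=> //=; apply/eqP => h0'; apply: hx; rewrite h0'.
Qed.

Lemma lebesgue_rV_compact_lty (R : realType) (n : nat) (X : set 'rV[R]_n) :
  compact X -> lebesgue_rV R n X < +oo.
Proof.
move=> cX; have [M [_ hM]] := compact_bounded cX.
(* The bound on norms holds only for reals strictly above [M], and the sides of the box need a
   nonnegative length. *)
pose c : R := (`|M| + 1)%R.
have c0 : (0 <= c)%R by rewrite addr_ge0.
apply: (@le_lt_trans _ _ (lebesgue_rV R n (box_rV (const_mx (- c)%R) (const_mx c)))).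
  apply: le_measure; rewrite ?inE.
  - apply: closed_measurable_borel.
    exact: (compact_closed (@norm_hausdorff _ _) cX).
  - exact: measurable_box_rV.
  move=> x Xx i; rewrite !mxE in_itv/= -ler_norml.
  apply: le_trans (hM c _ x Xx); last by rewrite ltr_pwDr// ler_norm.
  rewrite [leRHS]mx_normrE; exact: (le_bigmax _ (fun ij => `|x ij.1 ij.2|%R) (0%R, i)).
rewrite lebesgue_rV_box ?ltry// => i; rewrite !mxE.
by rewrite (@le_trans _ _ 0%R)// oppr_le0.
Qed.

(** * Upper bound *)

Section upper_bound.
Variables (R : realType) (n m : nat) (F : 'rV[R]_n -> 'rV[R]_m -> 'rV[R]_n).
Variables (X : set 'rV[R]_n) (U : set 'rV[R]_m) (alpha : R).
Hypotheses (cF : continuous (fun z : 'rV[R]_n * 'rV[R]_m => F z.1 z.2)).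
Hypotheses (cX : compact X) (cU : compact U) (alpha0 : (0 < alpha)%R).

Let clX : closed X := compact_closed (@norm_hausdorff _ _) cX.
Let clU : closed U := compact_closed (@norm_hausdorff _ _) cU.

Let mX : measurable (X : set (borel 'rV[R]_n)).
Proof. exact: closed_measurable_borel. Qed.

Let mXU : measurable (X `*` U : set (borel ('rV[R]_n * 'rV[R]_m)%type)).
Proof. by apply: closed_measurable_borel; exact: closed_setX. Qed.

Variables
  (mu : {finite_measure set (borel ('rV[R]_n * 'rV[R]_m)%type) -> \bar R})
  (mu0 muhat0 : {finite_measure set (borel 'rV[R]_n) -> \bar R}).
Hypothesis fea : feasible F X U alpha mu mu0 muhat0.

Let cfst : continuous (fst : 'rV[R]_n * 'rV[R]_m -> 'rV[R]_n).
Proof. by move=> z; exact: cvg_fst. Qed.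

(** For [h] vanishing exactly on [viable t], the left side of the Liouville equation is 0, so both
    nonnegative terms on the right vanish. The first gives the claim on [mu0]. As [alpha] is
    positive, the second says that [mu]-almost every successor lies in [viable t], whence its state
    lies in [viable t.+1]. *)
Lemma feasible_viable_step t :
  mu ((X `*` U) `&` [set z | ~ viable F X U t z.1]) = 0 ->
  mu0 (X `&` ~` viable F X U t) = 0 /\
  mu ((X `*` U) `&` [set z | ~ viable F X U t.+1 z.1]) = 0.
Proof.
move=> mut; have [h [ch h0 hK]] := closed_zero_set (closed_viable cF cX cU (t := t)).
have hN x : h x != 0%R <-> ~ viable F X U t x.
  by rewrite -hK; split=> /eqP.
have mh1 : measurable_fun (X `*` U : set (borel ('rV[R]_n * 'rV[R]_m)%type))
    (fun z => h z.1).
  apply: continuous_measurable_real => // z.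
  by apply: (@continuous_comp _ _ _ fst h); [exact: cfst|exact: ch].
have mhF : measurable_fun (X `*` U : set (borel ('rV[R]_n * 'rV[R]_m)%type))
    (fun z => h (F z.1 z.2)).
  apply: continuous_measurable_real => // z.
  by apply: (@continuous_comp _ _ _ (fun z => F z.1 z.2) h); [exact: cF|exact: ch].
have mh := continuous_measurable_real mX ch.
have := feasible_liouville fea ch.
have -> : \int[mu]_(z in X `*` U) (h z.1)%:E = 0.
  apply/(integral_eq0_null mu mXU mh1) => //; rewrite -[RHS]mut; congr (mu _).
  by apply/seteqP; split=> z [? /hN].
have I0ge0 : 0 <= \int[mu0]_(x in X) (h x)%:E.
  by apply: integral_ge0 => x _; rewrite lee_fin h0.
have I1ge0 : 0 <= \int[mu]_(z in X `*` U) (h (F z.1 z.2))%:E.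
  by apply: integral_ge0 => z _; rewrite lee_fin h0.
move=> /esym/eqP; rewrite padde_eq0 ?mule_ge0 ?lee_fin ?(ltW alpha0)//.
move=> /andP[/eqP I0 /eqP I1]; split.
  move/(integral_eq0_null mu0 mX mh h0) : I0 => I0.
  rewrite -[RHS]I0; congr (mu0 _).
  by apply/seteqP; split=> z [? /hN].
move: I1 => /eqP; rewrite mule_eq0 eqe gt_eqF//= => /eqP.
move/(integral_eq0_null mu mXU mhF (fun z => h0 _)) => I1.
apply: (subset_measure0 _ _ _ I1).
- apply: measurableI => //.
  rewrite (_ : [set z | _] = ~` (fst @^-1` viable F X U t.+1))//.
  apply: measurableC; apply: closed_measurable_borel.
  apply: preimage_closed; first by move=> z _; exact: cfst.
  exact: (closed_viable cF cX cU (t := t.+1)).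
- exact: measurable_neq0.
move=> [x u] /= [[Xx Uu] nv]; split=> //=; apply/hN => v; apply: nv.
by split=> //; exists u.
Qed.

Lemma feasible_viable t :
  mu ((X `*` U) `&` [set z | ~ viable F X U t z.1]) = 0.
Proof.
elim: t => [|t /feasible_viable_step[]//].
rewrite [X in mu X](_ : _ = set0) ?measure0//.
by apply/seteqP; split=> // z [[Xz _]].
Qed.

Let mMCI : measurable (MCI F X U : set (borel 'rV[R]_n)).
Proof. by apply: closed_measurable_borel; exact: closed_MCI. Qed.

Lemma feasible_mu0_MCI : mu0 (X `\` MCI F X U) = 0.
Proof.
apply/negligibleP; first exact: measurableD.
rewrite (MCI_viable cF cX cU) setDE setC_bigcap setI_bigcupr.
apply: negligible_bigcup => t; apply/negligibleP.
  apply: measurableI => //; apply: measurableC.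
  by apply: closed_measurable_borel; exact: closed_viable.
by have [] := feasible_viable_step (feasible_viable t).
Qed.

Let w (h : 'rV[R]_n -> R) (k : nat) (x : 'rV[R]_n) : R := (1 + k%:R * h x)^-1%R.

(* The continuous functions 1 / (1 + k h), with h vanishing exactly on the MCI
   set, decrease to its indicator function. *)
Lemma feasible_le : mu0 X <= lebesgue_rV R n (MCI F X U).
Proof.
have XIX : MCI F X U `<=` X by exact: MCI_sub.
have -> : mu0 X = mu0 (MCI F X U).
  rewrite -[in LHS](setDUK XIX) measureU//; last 2 first.
  - exact: measurableD.
  - exact: setDIK.
  by rewrite [X in _ + X]feasible_mu0_MCI adde0.
have [h [ch h0 hK]] := closed_zero_set (closed_MCI cF cX cU).
have d0 k x : (0 < 1 + k%:R * h x)%R by rewrite ltr_pwDl// mulr_ge0.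
have w0 k x : (0 <= w h k x)%R by rewrite invr_ge0 ltW.
have w1 k x : (w h k x <= 1)%R.
  by rewrite invf_le1// lerDl mulr_ge0.
have cw k : continuous (w h k).
  move=> x; apply: (@continuousV _ _ (fun x => 1 + k%:R * h x)%R); first by rewrite gt_eqF.
  apply: continuousD; first exact: cst_continuous.
  by apply: continuousM; [exact: cst_continuous|exact: ch].
have mw k : measurable_fun (X : set (borel 'rV[R]_n)) (w h k).
  exact: continuous_measurable_real.
have mwE k : measurable_fun (X : set (borel 'rV[R]_n)) (fun x => (w h k x)%:E).
  exact/measurable_EFinP.
have lX := lebesgue_rV_compact_lty cX.
(* The function equals 1 on the MCI set, and dropping the nonnegative [muhat0] term of the second
   constraint leaves an inequality with the Lebesgue integral. *)
have lek k : mu0 (MCI F X U) <= \int[lebesgue_rV R n]_(x in X) (w h k x)%:E.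
  rewrite -(feasible_lebesgue fea (continuous_subspaceT (cw k))).
  apply: (@le_trans _ _ (\int[mu0]_(x in X) (w h k x)%:E)); last first.
    by rewrite leeDl// integral_ge0// => x _; rewrite lee_fin.
  rewrite -[in leLHS](setIidl XIX) -integral_indic//; apply: ge0_le_integral => //.
  - by apply/measurable_EFinP; exact: measurable_indic.
  move=> x _; rewrite lee_fin indicE; case: (boolP (x \in _)) => [|_]; last exact: w0.
  by move=> /set_mem /hK hx0; rewrite /w hx0 mulr0 addr0 invr1.
have cvgw (x : 'rV[R]_n) : (w h k x)%:E @[k --> \oo] --> (\1_(MCI F X U) x)%:E.
  rewrite indicE; case: (boolP (x \in _)) => [/set_mem/hK hx0|].
    rewrite /w hx0; under eq_fun do rewrite mulr0 addr0 invr1; exact: cvg_cst.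
  rewrite notin_setE => nx; apply: cvg_EFin; first exact: nearW.
  have hx : (0 < h x)%R by rewrite lt0r h0 andbT; apply/eqP => /hK.
  apply/gtr0_cvgV0; first exact: nearW.
  apply/cvgryPge => A; near=> k.
  rewrite -lerBlDl -ler_pdivrMr//; near: k; exact: nbhs_infty_ger.
(* The dominating constant 1 is integrable because [X] has finite volume. *)
have [|||| _ _ cvgI] := @dominated_convergence _ _ _ (lebesgue_rV R n) X mX
    (fun k x => (w h k x)%:E) (fun x => (\1_(MCI F X U) x)%:E) (cst 1) mwE.
- by apply/measurable_EFinP; exact: measurable_indic.
- by apply: aeW => x _; exact: cvgw.
- apply: (@measurable_bounded_integrable _ _ _ _ (cst 1%R)) => //.
  exact: bounded_cst.
- by apply: aeW => x k _; rewrite /= lee_fin ger0_norm.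
rewrite integral_indic// setIidl// in cvgI.
have -> := esym (cvg_lim _ cvgI) => //.
apply: lime_ge; first by apply/cvg_ex; eexists; exact: cvgI.
exact: nearW.
Unshelve. all: by end_near. Qed.

End upper_bound.

(** * Discounted occupation measures and transfer of integrals *)

(** The target carries the sigma-algebra generated by the open sets of the product. The pair
    therefore factors through the concatenated row vector, which is measurable coordinatewise,
    followed by the continuous splitting [S]. *)
Lemma measurable_pair_borel (d : measure_display) (T : measurableType d)
    (R : realType) (n m : nat) (a : T -> 'rV[R]_n) (b : T -> 'rV[R]_m) :
  measurable_fun setT (a : T -> borel 'rV[R]_n) ->
  measurable_fun setT (b : T -> borel 'rV[R]_m) ->
  measurable_fun setT
    ((fun t => (a t, b t)) : T -> borel ('rV[R]_n * 'rV[R]_m)%type).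
Proof.
move=> ma mb.
pose S (y : 'rV[R]_(n + m)) : 'rV[R]_n * 'rV[R]_m := (lsubmx y, rsubmx y).
have cS : continuous S.
  apply: continuous_pair; apply: continuous_mx => i j.
    by under eq_fun do rewrite mxE; move=> z; exact: coord_continuous.
  by under eq_fun do rewrite mxE; move=> z; exact: coord_continuous.
have -> : (fun t => (a t, b t)) = S \o (fun t => row_mx (a t) (b t)).
  by apply/funext => t; rewrite /S /= row_mxKl row_mxKr.
apply: (@measurableT_comp _ _ _ _ _ _ (S : borel 'rV[R]_(n + m) -> borel _)).
  exact: continuous_measurable_borel.
apply: measurable_fun_borel_rV => i; case: (split_ordP i) => j ->.
  under eq_fun do rewrite row_mxEl.
  exact: (measurableT_comp (@measurable_coord_rV R n j) ma).
under eq_fun do rewrite row_mxEr.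
exact: (measurableT_comp (@measurable_coord_rV R m j) mb).
Qed.

(** All pushforwards of [mu0] have the same total mass, so the discounted masses form a geometric
    series and the sum is a finite measure. *)
Lemma discounted_occupation_measure (d d' : measure_display)
    (T : measurableType d) (T' : measurableType d') (R : realType)
    (mu0 : {finite_measure set T -> \bar R}) (phi : nat -> T -> T') (alpha : R) :
  (forall t, measurable_fun setT (phi t)) -> (0 < alpha < 1)%R ->
  exists mu : {finite_measure set T' -> \bar R}, forall A,
    mu A = \sum_(0 <= t <oo) (alpha ^+ t)%:E * mu0 (phi t @^-1` A).
Proof.
move=> mphi /andP[a0 a1].
have at0 t : (0 <= alpha ^+ t)%R by rewrite exprn_ge0// ltW.
pose nu0 t : {measure set T' -> \bar R} :=
  mscale (NngNum (at0 t)) (pushforward mu0 (phi t)).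
pose nu := nu0 mphi.
suff fin : mseries nu 0 setT < +oo.
  by exists (mfrestr measurableT fin) => A; rewrite /= /mfrestr /mrestr setIT.
rewrite /mseries /=.
have -> : \sum_(0 <= t <oo) nu t setT =
    \sum_(0 <= t <oo) (geometric (fine (mu0 setT)) alpha t)%:E.
  apply: eq_eseriesr => t _; rewrite /nu /nu0 /= /mscale /= /pushforward preimage_setT.
  by rewrite /geometric /= EFinM fineK ?fin_num_measure// muleC.
suff -> : \sum_(0 <= t <oo) (geometric (fine (mu0 setT)) alpha t)%:E =
    (fine (mu0 setT) / (1 - alpha))%:E by rewrite ltry.
apply: cvg_lim => //.
under eq_fun do rewrite sumEFin.
apply: cvg_EFin; first exact: nearW.
by apply: cvg_geometric_series; rewrite ger0_norm// ltW.
Qed.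

(** The nonnegative case applies to the positive and negative parts; integrability makes the
    negative part finite, so that [k] distributes over the difference. *)
Lemma integral_mscale (d : measure_display) (T : measurableType d)
    (R : realType) (k : {nonneg R}) (mu : {measure set T -> \bar R}) (D : set T)
    (h : T -> \bar R) : measurable D -> mu.-integrable D h ->
  \int[mscale k mu]_(x in D) h x = k%:num%:E * \int[mu]_(x in D) h x.
Proof.
move=> mD ih; have mh := measurable_int mu ih.
rewrite [LHS]integralE [X in _ = _ * X]integralE.
rewrite ge0_integral_mscale//; last exact: measurable_funepos.
rewrite ge0_integral_mscale//; last exact: measurable_funeneg.
by rewrite [RHS]muleBr// fin_num_adde_defl// fin_numN integrable_neg_fin_num.
Qed.

Lemma integrable_mscale (d : measure_display) (T : measurableType d)
    (R : realType) (k : {nonneg R}) (mu : {measure set T -> \bar R}) (D : set T)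
    (h : T -> \bar R) : measurable D -> mu.-integrable D h ->
  (mscale k mu).-integrable D h.
Proof.
move=> mD /integrableP[mh ih]; apply/integrableP; split=> //.
rewrite ge0_integral_mscale//; last exact: measurableT_comp.
by rewrite lte_mul_pinfty// lee_fin.
Qed.

Lemma integral_full_subset (d : measure_display) (T : measurableType d)
    (R : realType) (mu : {measure set T -> \bar R}) (D E : set T)
    (h : T -> \bar R) : measurable D -> measurable E -> E `<=` D ->
  mu (~` E) = 0 -> mu.-integrable D h ->
  \int[mu]_(x in D) h x = \int[mu]_(x in E) h x.
Proof.
move=> mD mE ED E0 ih; rewrite (negligible_integral (measurableC mE) mD ih E0).
by rewrite setDE setCK setIidr.
Qed.

(** The set identity says that the pushforward of [mu] by [p] is [mu0] plus [alpha] times its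
    pushforward by [q]. Integrating [h] and changing variables gives the weak form, which becomes
    the Liouville equation for [p] the projection to states and [q] the dynamics. *)
Lemma integral_pushforward_recursion (d d' : measure_display)
    (Z : measurableType d) (V : measurableType d') (R : realType)
    (mu : {measure set Z -> \bar R}) (mu0 : {measure set V -> \bar R})
    (p q : Z -> V) (alpha : R) (D : set V) (h : V -> \bar R) :
  measurable_fun setT p -> measurable_fun setT q -> (0 <= alpha)%R ->
  (forall A, measurable A -> mu (p @^-1` A) = mu0 A + alpha%:E * mu (q @^-1` A)) ->
  measurable D -> measurable_fun setT h -> mu0.-integrable D h ->
  mu.-integrable (p @^-1` D) (h \o p) -> mu.-integrable (q @^-1` D) (h \o q) ->
  \int[mu]_(z in p @^-1` D) h (p z) =
  \int[mu0]_(x in D) h x + alpha%:E * \int[mu]_(z in q @^-1` D) h (q z).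
Proof.
move=> mp mq a0 E mD mh i0 ip iq.
rewrite -[LHS](integral_pushforward mp mh ip mD).
rewrite -[X in _ + _ * X](integral_pushforward mq mh iq mD).
have iQ := integrable_pushforward mq mh iq mD.
pose nu0 : {measure set V -> \bar R} := pushforward mu q.
pose nu := nu0 mq.
rewrite [LHS](eq_measure_integral (measure_add mu0 (mscale (NngNum a0) nu))); last first.
  by move=> A mA _; rewrite [LHS]E//; apply/esym; exact: measure_addE.
rewrite integral_measure_add//; last exact: integrable_mscale.
by rewrite integral_mscale.
Qed.

Lemma continuous_compact_bounded (R : realType) (T : topologicalType)
    (K : set T) (h : T -> R) :
  compact K -> {within K, continuous h} -> [bounded h x | x in K].
Proof.
move=> cK ch; have [M [Mreal hM]] := compact_bounded (continuous_compact ch cK).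
by exists M; split=> // N MN x Kx; apply: (hM N MN); exists x.
Qed.

Lemma spt_sub (R : realType) (T : ptopologicalType) (nu : set (borel T) -> \bar R) (C : set T) :
  closed C -> nu (~` C) = 0 -> spt nu `<=` C.
Proof. by move=> cC C0 x; apply. Qed.

(** * Attainment *)

Section attainment.
Variables (R : realType) (n m : nat) (F : 'rV[R]_n -> 'rV[R]_m -> 'rV[R]_n).
Variables (X : set 'rV[R]_n) (U : set 'rV[R]_m) (alpha : R).
Hypotheses (cF : continuous (fun z : 'rV[R]_n * 'rV[R]_m => F z.1 z.2)).
Hypotheses (cX : compact X) (cU : compact U) (alpha01 : (0 < alpha < 1)%R).

Local Notation XI := (MCI F X U).
Local Notation borelXU := (borel ('rV[R]_n * 'rV[R]_m)%type).

Let clX : closed X := compact_closed (@norm_hausdorff _ _) cX.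
Let clU : closed U := compact_closed (@norm_hausdorff _ _) cU.
Let clXI : closed XI := closed_MCI cF cX cU.

Let mX : measurable (X : set (borel 'rV[R]_n)).
Proof. exact: closed_measurable_borel. Qed.

Let mXI : measurable (XI : set (borel 'rV[R]_n)).
Proof. exact: closed_measurable_borel. Qed.

Let mXU : measurable (X `*` U : set borelXU).
Proof. by apply: closed_measurable_borel; exact: closed_setX. Qed.

Lemma MCI_measurable_feedback : exists s : 'rV[R]_n -> 'rV[R]_m,
  measurable_fun setT (s : borel 'rV[R]_n -> borel 'rV[R]_m) /\
  forall x, XI x -> U (s x) /\ XI (F x (s x)).
Proof.
(* Requiring [XI x] makes the values empty off the MCI set, where the selection is unconstrained. *)
pose G (x : borel 'rV[R]_n) : set 'rV[R]_m :=
  [set u | XI x /\ U u /\ XI (F x u)].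
have mG : measurable_multifunction G.
  split=> [x|C cC].
    have [XIx|nXI] := pselect (XI x); last first.
      by rewrite (_ : G x = set0); [exact: compact0|apply/seteqP; split=> // u []].
    rewrite (_ : G x = U `&` (F x @^-1` XI)).
      apply: compact_closedI => //; apply: preimage_closed => // v _.
      have := @continuous_comp _ _ _ (fun w => (x, w)) (fun z => F z.1 z.2) v.
      by apply; [exact: pair_continuousr|exact: cF].
    by apply/seteqP; split=> [u [_ []]|u []].
  (* Restricting the controls to [C] leaves a compact set of controls, so these states form a
     compact, hence Borel, set. *)
  rewrite (_ : [set x | _] =
      [set x | XI x /\ exists2 u, (U `&` C) u & XI (F x u)]).
    apply: closed_measurable_borel; apply: (compact_closed (@norm_hausdorff _ _)).
    apply: (compact_controlled_preimage cF) => //; first exact: compact_MCI.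
    exact: compact_closedI.
  apply/seteqP; split=> [x [u [[XIx [Uu Fu]] Cu]]|x [XIx [u [Uu Cu] Fu]]].
    by split=> //; exists u.
  by exists u.
have [s [ms sG]] := measurable_selection mG.
exists s; split=> // x XIx.
have [|_ //] := sG x; have [u Uu Fu] := MCI_step XIx.
by exists u.
Qed.

Let lXI : lebesgue_rV R n XI < +oo := lebesgue_rV_compact_lty (compact_MCI cF cX cU).

Let mXD : measurable (X `\` XI : set (borel 'rV[R]_n)).
Proof. exact: measurableD. Qed.

Let lXD : lebesgue_rV R n (X `\` XI) < +oo.
Proof.
apply: le_lt_trans (lebesgue_rV_compact_lty cX).
by apply: le_measure; rewrite ?inE//; exact: subDsetl.
Qed.

Let mu0 : {finite_measure set (borel 'rV[R]_n) -> \bar R} := mfrestr mXI lXI.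
Let muhat0 : {finite_measure set (borel 'rV[R]_n) -> \bar R} := mfrestr mXD lXD.

(** The two measures restrict Lebesgue measure to complementary parts of [X]; boundedness of [w] on
    the compact [X] makes the integrals additive. *)
Lemma lebesgue_MCI_split (w : 'rV[R]_n -> R) : {within X, continuous w} ->
  \int[mu0]_(x in X) (w x)%:E + \int[muhat0]_(x in X) (w x)%:E =
  \int[lebesgue_rV R n]_(x in X) (w x)%:E.
Proof.
move=> cw; have mw := within_continuous_measurable_borel mX cw.
have bw := continuous_compact_bounded cX cw.
have fin (nu : {finite_measure set (borel 'rV[R]_n) -> \bar R}) : nu X < +oo.
  by rewrite -ge0_fin_numE// fin_num_measure.
have i0 (nu : {finite_measure set (borel 'rV[R]_n) -> \bar R}) :
    nu.-integrable X (EFin \o w).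
  by apply: measurable_bounded_integrable => //; exact: fin.
rewrite -[LHS](integral_measure_add mX (i0 mu0) (i0 muhat0)).
apply: eq_measure_integral => A mA AX; rewrite [LHS]measure_addE /= /mfrestr /mrestr.
rewrite -measureU//; last 3 first.
- exact: measurableI.
- exact: measurableI.
- by apply/seteqP; split=> // x [[_ ?] [_ []]].
congr (lebesgue_rV R n _); rewrite -setIUr setDUK ?setIidl//.
exact: MCI_sub.
Qed.

Lemma MCI_feasible : exists mu : {finite_measure set borelXU -> \bar R},
  feasible F X U alpha mu mu0 muhat0.
Proof.
have /andP[a0 a1] := alpha01.
have [s [ms sXI]] := MCI_measurable_feedback.
pose T x := F x (s x).
have mFz : measurable_fun setT
    ((fun z => F z.1 z.2) : borelXU -> borel 'rV[R]_n).
  exact: continuous_measurable_borel.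
have mfst : measurable_fun setT (fst : borelXU -> borel 'rV[R]_n).
  by apply: continuous_measurable_borel => z; exact: cvg_fst.
have mT : measurable_fun setT (T : borel 'rV[R]_n -> borel 'rV[R]_n).
  have mid : measurable_fun setT
      ((fun x => (x, s x)) : borel 'rV[R]_n -> borelXU).
    by apply: measurable_pair_borel => //; exact: measurable_id.
  exact: (measurableT_comp mFz mid).
have mTt t : measurable_fun setT (iter t T : borel 'rV[R]_n -> borel 'rV[R]_n).
  elim: t => [|t IH]; first exact: measurable_id.
  exact: (measurableT_comp mT IH).
pose phi t (x : borel 'rV[R]_n) : borelXU := (iter t T x, s (iter t T x)).
have mphi t : measurable_fun setT (phi t).
  by apply: measurable_pair_borel => //; exact: (measurableT_comp ms).
have [mu muE] := discounted_occupation_measure mu0 mphi alpha01.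
have muge0 t A : 0 <= (alpha ^+ t)%:E * mu0 (phi t @^-1` A).
  by rewrite mule_ge0// lee_fin exprn_ge0// ltW.
have TXI t x : XI x -> XI (iter t T x).
  by move=> XIx; elim: t => //= t /sXI[].
(* A closed set carrying [mu]: closed-loop trajectories from the MCI set stay there and use controls
   in [U]. *)
pose D0 : set ('rV[R]_n * 'rV[R]_m) := (XI `*` U) `&` [set z | XI (F z.1 z.2)].
have clD0 : closed D0.
  by apply: closedI; [exact: closed_setX|apply: preimage_closed].
have mD0 : measurable (D0 : set borelXU) by exact: closed_measurable_borel.
have muD0 : mu (~` D0) = 0.
  rewrite muE eseries0// => t _ _.
  rewrite [X in _ * X](_ : _ = 0) ?mule0//.
  rewrite /mu0 /= /mfrestr /mrestr (_ : _ `&` _ = set0) ?measure0//.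
  apply/seteqP; split=> // x [/= nD XIx]; apply: nD.
  have XIt := TXI t x XIx; have [Us Fs] := sXI _ XIt.
  by split=> //; split.
(* The term at time 0 is [mu0 A]. In the others, the state at time [t.+1] is the image under [F] of
   the pair at time [t], and one factor [alpha] comes out. *)
have rec A : measurable (A : set (borel 'rV[R]_n)) ->
    mu (fst @^-1` A) = mu0 A + alpha%:E * mu ((fun z => F z.1 z.2) @^-1` A).
  move=> mA; rewrite !muE (nneseries_recl (fun t _ => muge0 t _) erefl); congr (_ + _).
    by rewrite expr0 mul1e.
  rewrite -nneseriesZl; last by move=> t _; exact: muge0.
  rewrite -(nneseries_addn 1%N (fun t => muge0 t _)).
  by apply: eq_eseriesr => t _; rewrite muleA -EFinM addn1 -exprS.
have XIX : XI `<=` X by exact: MCI_sub.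
exists mu; split.
- apply: spt_sub; first exact: closed_setX.
  apply: (subset_measure0 _ _ _ muD0); [exact: measurableC|exact: measurableC|].
  by apply: subsetC => z [[/XIX]].
- apply: spt_sub => //.
  rewrite /= /mfrestr /mrestr (_ : _ `&` _ = set0) ?measure0//.
  by apply/seteqP; split=> // x [nX /XIX].
- apply: spt_sub => //.
  rewrite /= /mfrestr /mrestr (_ : _ `&` _ = set0) ?measure0//.
  by apply/seteqP; split=> // x [nX []].
- move=> v cv.
  have bv := continuous_compact_bounded cX (continuous_subspaceT cv).
  have cvF : continuous (fun z : 'rV[R]_n * 'rV[R]_m => v (F z.1 z.2)).
    by move=> z; apply: (@continuous_comp _ _ _ (fun z => F z.1 z.2) v); [exact: cF|exact: cv].
  have cvf : continuous (fun z : 'rV[R]_n * 'rV[R]_m => v z.1).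
    by move=> z; apply: (@continuous_comp _ _ _ fst v); [exact: cvg_fst|exact: cv].
  have fin D : measurable D -> mu D < +oo.
    by move=> mD; rewrite -ge0_fin_numE// fin_num_measure.
  have icont (g : 'rV[R]_n * 'rV[R]_m -> R) : continuous g ->
      mu.-integrable (X `*` U) (fun z => (g z)%:E).
    move=> cg; apply: measurable_bounded_integrable => //; first exact: fin.
      exact: continuous_measurable_real.
    by apply: continuous_compact_bounded; [exact: compact_setX|exact: continuous_subspaceT].
  (* These preimages of [X] can be unbounded; integrability comes from the bound of [v] on [X] and
     the finiteness of [mu]. *)
  have ipre (p : borelXU -> borel 'rV[R]_n) : continuous (p : 'rV[R]_n * 'rV[R]_m -> 'rV[R]_n) ->
      mu.-integrable (p @^-1` X) (fun z => (v (p z))%:E).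
    move=> cp; have mp := continuous_measurable_borel cp.
    have mpX : measurable (p @^-1` X) by rewrite -[X in measurable X]setTI; exact: mp.
    apply: measurable_bounded_integrable => //; first exact: fin.
      apply: continuous_measurable_real => // z.
      by apply: (@continuous_comp _ _ _ p v); [exact: cp|exact: cv].
    by have [M [Mreal hM]] := bv; exists M; split=> // N MN z pz; exact: hM.
  have mv : measurable_fun setT
      ((fun x => (v x)%:E) : borel 'rV[R]_n -> \bar R).
    by apply/measurable_EFinP; exact: continuous_measurable_real.
  have i0 : mu0.-integrable X (fun x => (v x)%:E).
    apply: measurable_bounded_integrable => //.
      by rewrite -ge0_fin_numE// fin_num_measure.
    exact: continuous_measurable_real.
  have i1 : mu.-integrable (fst @^-1` X) (fun z => (v z.1)%:E).
    by apply: ipre => z; exact: cvg_fst.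
  have i2 := ipre (fun z => F z.1 z.2) cF.
  have E := @integral_pushforward_recursion _ _ _ _ _ mu mu0 fst
    (fun z => F z.1 z.2) alpha X (fun x => (v x)%:E)
    mfst mFz (ltW a0) rec mX mv i0 i1 i2.
  have mpre (p : borelXU -> borel 'rV[R]_n) :
      measurable_fun setT p -> measurable (p @^-1` X).
    by move=> mp; rewrite -[X in measurable X]setTI; exact: mp.
  have D0XU : D0 `<=` X `*` U by move=> z [[/XIX]].
  have D0fst : D0 `<=` fst @^-1` X by move=> z [[/XIX]].
  have D0F : D0 `<=` (fun z => F z.1 z.2) @^-1` X by move=> z [_ /XIX].
  (* The constraint integrates over pairs from [X] and [U], the recursion over preimages of [X]. All
     these domains contain [D0], which carries [mu], so the integrals agree. *)
  rewrite (integral_full_subset mXU mD0 D0XU muD0 (icont _ cvf)).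
  rewrite (integral_full_subset mXU mD0 D0XU muD0 (icont _ cvF)).
  rewrite -(integral_full_subset (mpre _ mfst) mD0 D0fst muD0 i1).
  by rewrite -(integral_full_subset (mpre _ mFz) mD0 D0F muD0 i2).
exact: lebesgue_MCI_split.
Qed.

Lemma MCI_attained : exists mu nu nuhat, feasible F X U alpha mu nu nuhat /\
  forall A : set (borel 'rV[R]_n), nu A = lebesgue_rV R n (A `&` XI).
Proof. by have [mu fea] := MCI_feasible; exists mu, mu0, muhat0. Qed.

End attainment.

(** * Value of the linear program and its maximizer *)

Unset Implicit Arguments.

Theorem theorem1 (R : realType) (n m nX nU : nat)
    (f : 'I_n -> mpoly.mpoly (n + m) R)
    (gX : 'I_nX -> mpoly.mpoly n R) (gU : 'I_nU -> mpoly.mpoly m R)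
    (alpha : R) :
  let F := dynamics f in
  let X := semialgebraic_set gX in
  let U := semialgebraic_set gU in
  let XI := MCI F X U in
  compact X -> compact U -> (0 < alpha < 1)%R ->
  [/\ measurable (XI : set (borel 'rV[R]_n)),
      optimal_value F X U alpha = lebesgue_rV R n XI &
      exists mu mu0 muhat0,
        [/\ feasible F X U alpha mu mu0 muhat0,
            forall A : set (borel 'rV[R]_n), measurable A ->
              mu0 A = lebesgue_rV R n (A `&` XI) &
            mu0 X = optimal_value F X U alpha]].
Proof.
move=> F X U XI cX cU a01.
have cF : continuous (fun z : 'rV[R]_n * 'rV[R]_m => F z.1 z.2).
  exact: continuous_dynamics.
have [a0 _] := andP a01.
have XIX : XI `<=` X by exact: MCI_sub.
have mX : measurable (X : set (borel 'rV[R]_n)).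
  by apply: closed_measurable_borel; exact: (compact_closed (@norm_hausdorff _ _) cX).
have [mu [mu0 [muhat0 [fea mu0E]]]] := MCI_attained cF cX cU a01.
have pE : optimal_value F X U alpha = lebesgue_rV R n XI.
  apply/eqP; rewrite eq_le; apply/andP; split.
    by apply: ge_ereal_sup => _ [nu [nu0 [nuhat0 [nufea ->]]]];
      exact: (feasible_le cF cX cU a0 nufea).
  by apply: ereal_sup_ubound; exists mu, mu0, muhat0; rewrite mu0E setIidr.
split=> //.
  by apply: closed_measurable_borel; exact: closed_MCI.
by exists mu, mu0, muhat0; split=> //; rewrite pE mu0E setIidr.
Qed.
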